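(* Let $N,q,p$ be positive integers with $\gcd(N,q)=\gcd(N,p)=1$. Let $d=\gcd(p,q)$, $\tilde q=\frac{q}{d}$, $\tilde p=\frac{p}{d}$. Then $$B_{N,q,p}=B_{N,\tilde q,\tilde p}^{\,d}.$$
   Context: For positive integers $N,q,p$ with $\gcd(N,q)=\gcd(N,p)=1$, the braid $B_{N,q,p}$ is the $N$-braid consisting of the graphs over $[\eta,1+\eta]$ of the functions $$\psi_k(t)=\Big(\sin\tfrac{2\pi q}{N}(t+k),\ \cos\tfrac{2\pi p}{N}(t+k+\phi)\Big)\in\mathbb{R}^2,\qquad k=0,\dots,N-1,$$ where $\eta>0$ is a small number whose purpose is to avoid crossing points at the endpoints of the interval, and $\phi\in\mathbb{R}$ is a phase for which these graphs are pairwise disjoint. The element of the braid group is read from the projection onto $(t,\psi_k^{(1)}(t))$, where $\psi_k^{(1)}$ is the first component of $\psi_k$, strands being ordered by the value of $\psi_k^{(1)}$. The phase $\phi$ is dropped from the notation, since the knot type of the closure of the braid does not depend on $\phi$ up to mirror image. *)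

(* Defs.v *)
From HB Require Import structures.
From mathcomp Require Import all_boot all_order all_algebra finmap.
From mathcomp Require Import all_classical all_reals all_analysis.
Set Implicit Arguments.
Unset Strict Implicit.
Unset Printing Implicit Defensive.
Import Order.TTheory GRing.Theory Num.Theory.
Import numFieldNormedType.Exports.

(** A letter [(i, true)] stands for the generator sigma_(i+1), which exchanges
    the strands at positions [i] and [i.+1] (positions are counted from 0), and
    [(i, false)] for its inverse. *)
Notation letter N := ('I_N.-1 * bool)%type.

Notation word N := (seq (letter N)).

(** Artin's presentation of the braid group, as a congruence on words. *)
Inductive braid_eq (N : nat) : word N -> word N -> Prop :=
| braid_eq_refl u : braid_eq u u
| braid_eq_sym u v : braid_eq u v -> braid_eq v u
| braid_eq_trans u v w : braid_eq u v -> braid_eq v w -> braid_eq u w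
| braid_eq_cat u u' v v' :
    braid_eq u u' -> braid_eq v v' -> braid_eq (u ++ v) (u' ++ v')
| braid_eq_cancel i b : braid_eq [:: (i, b); (i, ~~ b)] [::]
| braid_eq_far (i j : 'I_N.-1) : i.+1 < j ->
    braid_eq [:: (i, true); (j, true)] [:: (j, true); (i, true)]
| braid_eq_artin (i j : 'I_N.-1) : i.+1 = j ->
    braid_eq [:: (i, true); (j, true); (i, true)]
             [:: (j, true); (i, true); (j, true)].

Section BraidGroup.
Variable N : nat.

Let eqb (u v : word N) : bool := `[< braid_eq u v >].

Let eqb_equiv : equiv_class_of eqb.
Proof.
split=> [u|u v|v u w].
- exact/asboolP/braid_eq_refl.
- by apply/asboolP/asboolP; apply: braid_eq_sym.
- move=> /asboolP uv /asboolP vw; apply/asboolP; exact: braid_eq_trans uv vw.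
Qed.

Definition braid_equiv : equiv_rel (word N) := EquivRelPack eqb_equiv.

Definition braid_group : Type := {eq_quot braid_equiv}%qT.
HB.instance Definition _ := Choice.on braid_group.

Definition braid_of_word (w : word N) : braid_group := \pi_({eq_quot braid_equiv})%qT w.

Lemma braid_of_wordP (u v : word N) :
  braid_of_word u = braid_of_word v <-> braid_eq u v.
Proof.
split; first by move=> /eqmodP /asboolP.
by move=> uv; apply/eqmodP/asboolP.
Qed.

Definition word_inv (w : word N) : word N := rev [seq (x.1, ~~ x.2) | x <- w].

Definition braid_mul (x y : braid_group) : braid_group :=
  braid_of_word (repr (x : {eq_quot braid_equiv}%qT)
                 ++ repr (y : {eq_quot braid_equiv}%qT)).
Definition braid_one : braid_group := braid_of_word [::].
Definition braid_inv (x : braid_group) : braid_group :=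
  braid_of_word (word_inv (repr (x : {eq_quot braid_equiv}%qT))).

Let braid_repr (x : braid_group) :
  x = braid_of_word (repr (x : {eq_quot braid_equiv}%qT)).
Proof. by rewrite /braid_of_word reprK. Qed.

Let repr_eq (w : word N) :
  braid_eq (repr (braid_of_word w : {eq_quot braid_equiv}%qT)) w.
Proof. by apply/braid_of_wordP; rewrite -braid_repr. Qed.

Lemma braid_of_word_cat (u v : word N) :
  braid_of_word (u ++ v) = braid_mul (braid_of_word u) (braid_of_word v).
Proof.
apply/braid_of_wordP/braid_eq_cat; exact/braid_eq_sym/repr_eq.
Qed.

Let word_invK : involutive word_inv.
Proof.
move=> w; rewrite /word_inv map_rev revK -map_comp -[RHS]map_id.
by apply: eq_map => -[i b] /=; rewrite negbK.
Qed.

Let word_inv_cat (u : word N) : braid_eq (u ++ word_inv u) [::].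
Proof.
elim: u => [|[i b] u IH]; first exact: braid_eq_refl.
rewrite /word_inv map_cons rev_cons -cats1 cat_cons catA -/(word_inv u).
apply: braid_eq_trans (braid_eq_cancel i b).
apply: (braid_eq_cat (braid_eq_refl [:: (i, b)])).
exact: (braid_eq_cat IH (braid_eq_refl [:: (i, ~~ b)])).
Qed.

Let braid_mulA : associative braid_mul.
Proof.
move=> x y z; rewrite (braid_repr x) (braid_repr y) (braid_repr z).
by rewrite -!braid_of_word_cat catA.
Qed.

Let braid_mul1 : left_id braid_one braid_mul.
Proof. by move=> x; rewrite (braid_repr x) -braid_of_word_cat. Qed.

Let braid_mulr1 : right_id braid_one braid_mul.
Proof. by move=> x; rewrite (braid_repr x) -braid_of_word_cat cats0. Qed.

Let braid_mulrV : right_inverse braid_one braid_inv braid_mul.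
Proof.
move=> x; rewrite {1}(braid_repr x) -braid_of_word_cat.
exact/braid_of_wordP/word_inv_cat.
Qed.

Let braid_mulV : left_inverse braid_one braid_inv braid_mul.
Proof.
move=> x; rewrite {2}(braid_repr x) -braid_of_word_cat.
apply/braid_of_wordP.
by have := word_inv_cat (word_inv (repr (x : {eq_quot braid_equiv}%qT)));
   rewrite word_invK.
Qed.

HB.instance Definition _ := isGroup.Build braid_group
  braid_mulA braid_mul1 braid_mulr1 braid_mulV braid_mulrV.

End BraidGroup.

Local Open Scope classical_set_scope.
Local Open Scope ring_scope.

Section Projection.
Variables (R : realType) (N : nat).

(** [f k] is the [k]-th strand, parametrised by the time [t]; the projection
    keeps [t] and the first component of [f k t]. *)
Variable f : 'I_N -> R -> R * R.

Definition disjoint_graphs (a b : R) : Prop :=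
  forall k l : 'I_N, k != l -> forall t, a <= t <= b -> f k t <> f l t.

Definition position (t : R) (k : 'I_N) : nat :=
  #|[pred j : 'I_N | (f j t).1 < (f k t).1]|.

(** The strands [k] (going up) and [l] (going down) cross in the projection at
    time [t], at positions [i] and [i.+1]. *)
Definition crossing (t : R) (i : nat) (k l : 'I_N) : Prop :=
  [/\ (f k t).1 = (f l t).1, position t k = i,
      \forall s \near t^'-, (f k s).1 < (f l s).1 &
      \forall s \near t^'+, (f l s).1 < (f k s).1].

(** A crossing is positive when the strand going up has the larger second
    component. *)
Definition letter_at (t : R) (x : letter N) : Prop :=
  exists k l : 'I_N, crossing t x.1 k l /\ x.2 = ((f l t).2 < (f k t).2).

(** Several crossings may occur at the same time; for strands in general
    position (double points only, transverse) these involve disjoint pairs of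
    positions, so the letters commute and the order in which [enum] lists them
    is immaterial. *)
Definition slice_word (t : R) : word N :=
  [seq x <- enum {: letter N} | `[< letter_at t x >]].

Definition crossing_times (a b : R) : set R :=
  [set t | a <= t <= b /\
    exists k l : 'I_N, k != l /\ (f k t).1 = (f l t).1].

(** Crossings are read by increasing time; [fset_set] is meaningful because
    there are finitely many crossing times for strands in general position. *)
Definition projection_word (a b : R) : word N :=
  flatten [seq slice_word t
          | t <- sort <=%O (enum_fset (fset_set (crossing_times a b)))].

Definition read_braid (a b : R) : braid_group N :=
  braid_of_word (projection_word a b).

End Projection.

Section LissajousBraid.
Variable R : realType.

Definition psi (N q p : nat) (phi : R) (k : 'I_N) (t : R) : R * R :=
  (sin (2 * pi * q%:R / N%:R * (t + k%:R)),
   cos (2 * pi * p%:R / N%:R * (t + k%:R + phi))).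

(** The interval [[eta, 1 + eta]] spans one period of the set of strands, since
    [psi k (t + 1)] is [psi (k + 1 mod N) t]. For small [eta > 0] no crossing
    lies at its ends and the braid does not depend on [eta]. *)
Definition admissible_phase (N q p : nat) (phi eta : R) : Prop :=
  disjoint_graphs (psi (N := N) q p phi) eta (1 + eta).

Definition lissajous_braid (N q p : nat) (phi eta : R) : braid_group N :=
  read_braid (psi (N := N) q p phi) eta (1 + eta).

End LissajousBraid.

(* Main.v *)
Require Import Defs.
From mathcomp Require Import all_boot all_order all_algebra finmap.
From mathcomp Require Import all_classical all_reals all_analysis.
From mathcomp Require Import ring lra zify.
Import Order.TTheory GRing.Theory Num.Theory.
Import numFieldNormedType.Exports.
Local Open Scope classical_set_scope.
Local Open Scope ring_scope.

(** Put [d = gcd(p, q)], [q = d q'] and [p = d p'].  Substituting into the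
    formula for the strands gives
    [psi_k^{N,q,p,phi}(t) = psi_{dk mod N}^{N,q',p',d phi}(d t)], and
    [k |-> dk mod N] permutes the labels because [d], a divisor of [q], is prime
    to [N].  So, up to relabelling its strands, the geometric braid [B_{N,q,p}]
    over [[eta, 1 + eta]] is the family of strands of [B_{N,q',p'}] run through
    the interval [[d eta, d + d eta]] of length [d]
    ([psi_dilate]).  Relabelling changes nothing in the braid that is read,
    since strands are ordered by position ([read_braid_affine]).

    The family of strands has period 1 up to the cyclic relabelling
    [k |-> k + 1] ([psi_period]), so the interval of length [d] splits into [d]
    unit intervals over which the same braid is read ([read_braid_periodic]).
    It remains to replace the starting point [d eta] by [eta'].  Solving
    [sin x = sin y] shows that a crossing of [B_{N,q',p'}] can only happen at a
    time [t] with [4 q' t] an integer ([psi_crossing_lattice]).  Hence there are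
    finitely many crossings in a bounded interval, and a unit window starting
    anywhere in the gap between 0 and [1 / 4q'] contains the same ones
    ([psi_window]).

    The argument never applies a braid relation: the two sides are read from
    the same sequence of crossings.  Disjointness of the graphs is compared in
    the same way: by periodicity it holds over one period iff it holds at all
    times ([disjoint_graphs_period]), and the latter condition is invariant
    under affine changes of time and relabelling. *)

Set Implicit Arguments.
Unset Strict Implicit.
Unset Printing Implicit Defensive.

(** * One-sided neighbourhoods under increasing affine maps *)

Section OneSidedLimits.
Variable R : realType.

Let near_affine (c b t : R) (P : R -> Prop) :
  (\forall s \near (c * t + b), P s) -> \forall s \near t, P (c * s + b).
Proof.
have cont : (fun s => c * s + b) @ t --> c * t + b.
  by apply: cvgD; [apply: cvgM; [exact: cvg_cst|exact: cvg_id]|exact: cvg_cst].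
exact: cont.
Qed.

(** Pulling back along an affine map is continuity; the converse is the same
    fact for the inverse map. The order [lt] is a parameter so that both sides
    are treated at once. *)
Let near_side_affine (lt : rel R) (c b t : R) (P : R -> Prop) :
    (forall c b x y, 0 < c -> lt (c * x + b) (c * y + b) = lt x y) -> 0 < c ->
  (\forall s \near within (lt^~ t) (nbhs t), P (c * s + b)) <->
  (\forall s \near within (lt^~ (c * t + b)) (nbhs (c * t + b)), P s).
Proof.
move=> ltE.
have pull c' b' u (Q : R -> Prop) : 0 < c' ->
    (\forall s \near within (lt^~ (c' * u + b')) (nbhs (c' * u + b')), Q s) ->
    \forall s \near within (lt^~ u) (nbhs u), Q (c' * s + b').
  by move=> c'0 /near_affine; apply: filterS => s /=; rewrite ltE.
move=> c_gt0; split; last exact: pull.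
have cN0 : c != 0 by rewrite gt_eqF.
have inv x : c^-1 * (c * x + b) - c^-1 * b = x by field.
have cV_gt0 : 0 < c^-1 by rewrite invr_gt0.
rewrite -{1 2}(inv t) => /(pull _ _ _ (fun s => P (c * s + b)) cV_gt0).
by apply: filterS => s; congr P; field.
Qed.

Lemma near_left_affine (c b t : R) (P : R -> Prop) : 0 < c ->
  (\forall s \near t^'-, P (c * s + b)) <-> (\forall s \near (c * t + b)^'-, P s).
Proof.
apply: (@near_side_affine (fun x y => x < y)) => {}c {}b x y c_gt0.
by rewrite ltrD2r ltr_pM2l.
Qed.

Lemma near_right_affine (c b t : R) (P : R -> Prop) : 0 < c ->
  (\forall s \near t^'+, P (c * s + b)) <-> (\forall s \near (c * t + b)^'+, P s).
Proof.
apply: (@near_side_affine (fun x y => y < x)) => {}c {}b x y c_gt0.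
by rewrite ltrD2r ltr_pM2l.
Qed.

End OneSidedLimits.

(** * Splitting and reparametrizing the reading of a braid *)

Section ReadingBraids.
Variables (R : realType) (N : nat).
Implicit Types (f g : 'I_N -> R -> R * R) (a b c t : R) (r : seq R).

Definition disjoint_at f t : Prop := forall k l, k != l -> f k t <> f l t.

(** Frees later proofs from the choice of an enumeration of the set of crossing
    times: any increasing list of them will do. *)
Lemma projection_word_sorted f a b r : sorted <%R r ->
    (forall t, crossing_times f a b t <-> t \in r) ->
  projection_word f a b = flatten (map (slice_word f) r).
Proof.
move=> r_sorted rP; rewrite /projection_word; congr (flatten (map _ _)).
have fin : finite_set (crossing_times f a b).
  by apply/finite_seqP; exists r; apply/seteqP; split=> t /rP.
apply: lt_sorted_eq => //.
  by rewrite sort_lt_sorted fset_uniq.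
move=> t; rewrite mem_sort; transitivity (t \in crossing_times f a b).
  by rewrite -in_fset_set.
by apply/idP/idP; rewrite in_setE => /rP.
Qed.

Lemma finite_crossing_list f a b : finite_set (crossing_times f a b) ->
  exists2 r, sorted <%R r & forall t, crossing_times f a b t <-> t \in r.
Proof.
move=> /finite_seqP[r rP]; exists (sort <=%O (undup r)).
  by rewrite sort_lt_sorted undup_uniq.
by move=> t; rewrite mem_sort mem_undup rP.
Qed.

(** A crossing at time [b] would be read in both factors, hence the last
    hypothesis. *)
Lemma read_braid_cat f a b c : a <= b <= c ->
    finite_set (crossing_times f a c) -> ~ crossing_times f b b b ->
  read_braid f a c = (read_braid f a b * read_braid f b c)%g.
Proof.
move=> /andP[ab bc] fin_ac noncross_b.
have [r1 r1_sorted r1P] : exists2 r, sorted <%R r &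
    forall t, crossing_times f a b t <-> t \in r.
  apply/finite_crossing_list/(sub_finite_set _ fin_ac) => t [/andP[at_ tb] kl].
  by split=> //; rewrite at_ (le_trans tb bc).
have [r2 r2_sorted r2P] : exists2 r, sorted <%R r &
    forall t, crossing_times f b c t <-> t \in r.
  apply/finite_crossing_list/(sub_finite_set _ fin_ac) => t [/andP[bt tc] kl].
  by split=> //; rewrite tc (le_trans ab bt).
rewrite /read_braid (@projection_word_sorted f a c (r1 ++ r2)).
- rewrite map_cat flatten_cat braid_of_word_cat.
  by rewrite -(projection_word_sorted r1_sorted r1P) -(projection_word_sorted r2_sorted r2P).
- (* a common time of the two lists could only be the cut [b] *)
  rewrite (sorted_pairwise lt_trans) pairwise_cat -!(sorted_pairwise lt_trans).
  rewrite r1_sorted r2_sorted !andbT; apply/allrelP => x y.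
  move=> /r1P[/andP[_ xb] x_cross] /r2P[/andP[by_ _] _].
  apply: lt_le_trans by_; rewrite lt_neqAle xb andbT.
  by apply/eqP => xbE; apply: noncross_b; split; rewrite ?lexx // -xbE.
- move=> t; rewrite mem_cat; split=> [[/andP[at_ tc] t_cross]|/orP[/r1P|/r2P]].
  + case: (leP t b) => [tb|/ltW bt].
      by apply/orP; left; apply/r1P; rewrite /crossing_times /= at_ tb.
    by apply/orP; right; apply/r2P; rewrite /crossing_times /= bt tc.
  + by move=> [/andP[at_ tb] t_cross]; split=> //; rewrite at_ (le_trans tb bc).
  + by move=> [/andP[bt tc] t_cross]; split=> //; rewrite (le_trans ab bt).
Qed.

(** The reading only sees the unlabelled set of strands, so it is unchanged by
    a permutation [s] of the labels, and an increasing change of time keeps the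
    order of the crossings and their signs. *)
Section AffineReparametrization.
Variables (f g : 'I_N -> R -> R * R) (s : 'I_N -> 'I_N) (c b : R).
Hypotheses (s_inj : injective s) (c_gt0 : 0 < c).
Hypothesis gE : forall k t, g k t = f (s k) (c * t + b).

Let s_onto l : exists k, l = s k.
Proof. by have [s' _ s'K] := injF_bij s_inj; exists (s' l). Qed.

Lemma position_affine t k : position g t k = position f (c * t + b) (s k).
Proof.
rewrite /position -!sum1_card [RHS](reindex s) /=; last exact/onW_bij/injF_bij.
by apply: eq_bigl => j; rewrite !inE !gE.
Qed.

Lemma crossing_affine t i k l :
  crossing g t i k l <-> crossing f (c * t + b) i (s k) (s l).
Proof.
have gfE : g = fun k t => f (s k) (c * t + b).
  by apply/funext => j; apply/funext => u; exact: gE.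
rewrite /crossing position_affine gfE.
have leftP := near_left_affine b t
  (fun u => (f (s k) u).1 < (f (s l) u).1) c_gt0.
have rightP := near_right_affine b t
  (fun u => (f (s l) u).1 < (f (s k) u).1) c_gt0.
by split=> -[? ? /leftP ? /rightP ?].
Qed.

Lemma slice_word_affine t : slice_word g t = slice_word f (c * t + b).
Proof.
apply: eq_filter => x; apply/asboolP/asboolP => -[k [l [kl xE]]].
  by exists (s k), (s l); rewrite xE !gE; split=> //; apply/crossing_affine.
have [[k' kE] [l' lE]] := (s_onto k, s_onto l); exists k', l'.
by rewrite xE !gE -kE -lE; split=> //; apply/crossing_affine; rewrite -kE -lE.
Qed.

Lemma crossing_times_affine a e t :
  crossing_times g a e t <-> crossing_times f (c * a + b) (c * e + b) (c * t + b).
Proof.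
rewrite /crossing_times /= !lerD2r !ler_pM2l //.
split=> -[-> [k [l [kl klE]]]]; split=> //.
  by exists (s k), (s l); rewrite (inj_eq s_inj) -!gE.
have [[k' kE] [l' lE]] := (s_onto k, s_onto l); exists k', l'.
by rewrite !gE -kE -lE; split=> //; apply: contra_neq kl; rewrite kE lE => ->.
Qed.

Lemma read_braid_affine a e :
    finite_set (crossing_times g a e) ->
  read_braid g a e = read_braid f (c * a + b) (c * e + b).
Proof.
move=> /finite_crossing_list[r r_sorted rP]; congr braid_of_word.
rewrite (projection_word_sorted r_sorted rP).
rewrite (@projection_word_sorted f _ _ [seq c * t + b | t <- r]).
- by rewrite -map_comp; congr flatten; apply: eq_map; exact: slice_word_affine.
- rewrite sorted_map; apply: sub_sorted r_sorted => x y /=.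
  by rewrite ltrD2r ltr_pM2l.
- have tE u : u = c * (c^-1 * (u - b)) + b by field; rewrite gt_eqF.
  move=> t; split=> [|/mapP[u /rP ur ->]]; last exact/crossing_times_affine.
  by rewrite {1}(tE t) => /crossing_times_affine/rP; rewrite {2}(tE t) => /map_f ->.
Qed.

Lemma disjoint_at_affine t : disjoint_at g t <-> disjoint_at f (c * t + b).
Proof.
split=> disj k l kl; last by rewrite !gE; apply: disj; rewrite (inj_eq s_inj).
have [[k' kE] [l' lE]] := (s_onto k, s_onto l).
by rewrite kE lE -!gE; apply: disj; apply: contra_neq kl; rewrite kE lE => ->.
Qed.

End AffineReparametrization.

Section Periodicity.
Variables (f : 'I_N -> R -> R * R) (s : 'I_N -> 'I_N) (T : R).
Hypotheses (s_inj : injective s) (T_gt0 : 0 < T).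
Hypothesis fT : forall k t, f k (t + T) = f (s k) t.

(* [f] over a window is [f] over the next window, relabelled by [s^-1] *)
Let next_window : exists2 s' : 'I_N -> 'I_N, injective s' &
  forall k t, f k t = f (s' k) (1 * t + T).
Proof.
have [s' sK s'K] := injF_bij s_inj; exists s'; first exact: can_inj s'K.
by move=> k t; rewrite mul1r fT s'K.
Qed.

Lemma read_braid_periodic (a : R) n :
    (forall b c, finite_set (crossing_times f b c)) ->
    ~ crossing_times f a a a ->
  read_braid f a (a + T *+ n) = (read_braid f a (a + T) ^+ n)%g.
Proof.
have [s' s'_inj fE] := next_window; move=> fin noncross.
elim: n => [|n IHn].
  rewrite mulr0n addr0 expg0 /read_braid (@projection_word_sorted f a a [::]) //.
  move=> t; split=> // -[/andP[at_ ta] t_cross].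
  have ta_eq : t = a by apply/le_anti/andP.
  by case: noncross; split; rewrite ?lexx // -ta_eq.
have nT_ge0 : 0 <= T *+ n by rewrite mulrn_wge0 ?ltW.
rewrite (@read_braid_cat f a (a + T)) // ?expgS; last 2 first.
- by rewrite mulrS addrA !lerDl ltW.
- have := crossing_times_affine s'_inj ltr01 fE a a a.
  by rewrite mul1r => H /H.
congr (_ * _)%g; rewrite -IHn [RHS](read_braid_affine s'_inj ltr01 fE) // !mul1r.
by congr read_braid; rewrite mulrS; ring.
Qed.

Lemma disjoint_graphs_period a :
  disjoint_graphs f a (a + T) <-> forall t, disjoint_at f t.
Proof.
have [s' s'_inj fE] := next_window.
split=> [disj t|disj k l kl t _]; last exact: disj.
have nat_shift u n : disjoint_at f u <-> disjoint_at f (u + T *+ n).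
  elim: n => [|n IHn]; first by rewrite mulr0n addr0.
  apply: (iff_trans IHn); apply: (iff_trans (disjoint_at_affine s'_inj fE _)).
  by rewrite mul1r mulrSr addrA.
(* move [t] into the window by a whole number of periods *)
set m := Num.floor ((t - a) / T); pose u := t - T *~ m.
have u_disj : disjoint_at f u.
  move=> k l kl; apply: disj kl _ _; rewrite /u -[T *~ m]mulrzr.
  have m_le : m%:~R * T <= t - a by rewrite -ler_pdivlMr // floor_le_tmp.
  have lt_m : t - a < (m%:~R + 1) * T.
    by rewrite -ltr_pdivrMr // -intrD1 floorD1_gt.
  by apply/andP; split; lra.
have -> : t = u + T *~ m by rewrite /u subrK.
case: (m) u_disj => n; first by move=> /(nat_shift u n).
by rewrite NegzE mulrNz => u_disj; apply/(nat_shift _ n.+1); rewrite subrK.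
Qed.

End Periodicity.

End ReadingBraids.

(** * Solutions of the equation sin x = sin y *)

Section Trigonometry.
Variable R : realType.
Implicit Types (x y c a b : R).

Let sin_pi_int (m : int) : sin (pi * m%:~R) = 0 :> R.
Proof.
have nat_case (n : nat) : sin (pi * n%:R) = 0 :> R.
  by elim: n => [|n IHn]; rewrite ?mulr0 ?sin0 // -natr1 mulrDr mulr1 sinDpi IHn oppr0.
case: m => n; first exact: nat_case.
by rewrite NegzE mulrNz mulrN sinN nat_case oppr0.
Qed.

Lemma sin_pi_eq0 x : sin (pi * x) = 0 -> x \is a Num.int.
Proof.
move=> sinx0; set m := Num.floor x.
have sinr0 : sin (pi * (x - m%:~R)) = 0.
  by rewrite mulrBr sinB sinx0 sin_pi_int mul0r mulr0 subrr.
have m_le : 0 <= x - m%:~R by rewrite subr_ge0 floor_le_tmp.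
have lt_m : x - m%:~R < 1 by rewrite ltrBlDr addrC -intrD1 floorD1_gt.
have [/subr0_eq->|xm] := eqVneq (x - m%:~R) 0; first exact: intr_int.
have r_gt0 : 0 < x - m%:~R by rewrite lt_neqAle eq_sym xm.
have /sin_gt0_pi : 0 < pi * (x - m%:~R) < pi.
  by rewrite mulr_gt0 ?pi_gt0 //= gtr_pMr ?pi_gt0.
by rewrite sinr0 ltxx.
Qed.

Lemma sin_pi_eq x y : sin (pi * x) = sin (pi * y) ->
  (x - y) / 2 \is a Num.int \/ (x + y + 1) / 2 \is a Num.int.
Proof.
move=> sinxy; set u := (x + y) / 2; set v := (x - y) / 2.
have xE : pi * x = pi * u + pi * v by rewrite /u /v; field.
have yE : pi * y = pi * u - pi * v by rewrite /u /v; field.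
have /eqP : cos (pi * u) * sin (pi * v) = 0.
  by move: sinxy; rewrite xE yE sinD sinB; lra.
rewrite mulf_eq0 => /orP[/eqP cosu0|/eqP/sin_pi_eq0]; last by left.
right; apply: sin_pi_eq0; rewrite -cosu0 -sinDpihalf; congr sin.
by rewrite /u; field.
Qed.

Lemma finite_lattice_itv c a b : 0 < c ->
  finite_set [set t : R | a <= t <= b /\ c * t \is a Num.int]%classic.
Proof.
move=> c_gt0; set A := [set _ | _]%classic.
set m := Num.floor (c * a); set n := Num.floor (c * b).
pose F (i : nat) : R := (m + i%:Z)%:~R / c.
apply: (@sub_finite_set _ _ (F @` `I_(`|n - m|%N).+1)%classic); last first.
  exact/finite_image/finite_II.
move=> t [/andP[at_ tb] /intrP[z zE]].
have mz : m <= z.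
  by rewrite -(@ler_int R) -zE (le_trans (floor_le_tmp _)) // ler_pM2l.
have zn : z <= n by rewrite floor_ge_int_tmp -zE ler_pM2l.
exists `|z - m|%N => /=; first by lia.
rewrite /F gez0_abs ?subr_ge0 // subrKC -zE; field.
by rewrite gt_eqF.
Qed.

End Trigonometry.

(** * Lissajous strands: symmetries and crossing times *)

Section LissajousStrands.
Variables (R : realType) (N : nat).
Hypothesis N_gt0 : (0 < N)%N.

Definition strand_mod (m : nat) : 'I_N := Ordinal (ltn_pmod m N_gt0).

(** The strand with label [m mod N] is given by the formula for [psi] with [m]
    itself in place of the label; this makes every symmetry of the family a
    comparison of formulas. *)
Lemma psi_strand_mod (q p m : nat) (phi t : R) :
  psi q p phi (strand_mod m) t =
    (sin (2 * pi * q%:R / N%:R * (t + m%:R)),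
     cos (2 * pi * p%:R / N%:R * (t + m%:R + phi))).
Proof.
have N0 : N%:R != 0 :> R by rewrite pnatr_eq0 -lt0n.
have mE : m%:R = (m %/ N)%:R * N%:R + (m %% N)%:R :> R.
  by rewrite -natrM -natrD -divn_eq.
have turn (n : nat) (x y : R) : y = x + (m %/ N)%:R * N%:R ->
    2 * pi * n%:R / N%:R * y =
    2 * pi * n%:R / N%:R * x + (pi *+ 2) *+ (n * (m %/ N)).
  by move=> ->; rewrite -[_ *+ (_ * _)]mulr_natr natrM; field.
congr (_, _) => /=.
    rewrite -(periodicn (@sinD2pi R) (q * (m %/ N))).
  by rewrite -(turn _ _ (t + m%:R)) // mE; ring.
rewrite -(periodicn (@cosD2pi R) (p * (m %/ N))).
by rewrite -(turn _ _ (t + m%:R + phi)) // mE; ring.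
Qed.

Lemma strand_mod_affine_inj (d b : nat) : coprime N d ->
  injective (fun k : 'I_N => strand_mod (d * k + b)).
Proof.
move=> coNd k l /(congr1 val) /= /eqP; rewrite eqn_modDr.
wlog kl : k l / (k <= l)%N.
  move=> W; case/orP: (leq_total k l) => kl; first exact: W.
  by rewrite eq_sym => /W ->.
rewrite eq_sym eqn_mod_dvd ?leq_mul2l ?kl ?orbT // -mulnBr Gauss_dvdr //.
move=> N_dvd; apply/val_inj/eqP; rewrite eqn_leq kl /=.
rewrite -subn_eq0; case: posnP => // lk_gt0.
by have := dvdn_leq lk_gt0 N_dvd; have := ltn_ord l; lia.
Qed.

Lemma psi_dilate (d q p : nat) (phi : R) (k : 'I_N) (t : R) :
  psi (d * q) (d * p) phi k t
    = psi q p (d%:R * phi) (strand_mod (d * k + 0)) (d%:R * t + 0).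
Proof.
rewrite psi_strand_mod addn0 addr0 /psi !natrM.
by congr (sin _, cos _); ring.
Qed.

Lemma psi_period (q p : nat) (phi : R) (k : 'I_N) (t : R) :
  psi q p phi k (t + 1) = psi q p phi (strand_mod (1 * k + 1)) t.
Proof.
by rewrite psi_strand_mod mul1n natrD /psi; congr (sin _, cos _); ring.
Qed.

Variables (q p : nat) (phi : R).
Hypotheses (q_gt0 : (0 < q)%N) (coNq : coprime N q).
Let f := psi (N := N) q p phi.

(** Equality of the sines of two angles means that their difference or
    their sum is prescribed. The first would force [N] to divide [q (k - l)],
    which is impossible for distinct labels; the second does not depend on
    [k - l] and gives the time of crossing. *)
Lemma psi_crossing_lattice (a b t : R) :
  crossing_times f a b t -> (4 * q%:R) * t \is a Num.int.
Proof.
have N0 : N%:R != 0 :> R by rewrite pnatr_eq0 -lt0n.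
move=> [_ [k [l [/eqP kl /= sinE]]]].
pose angle (j : 'I_N) := 2 * q%:R / N%:R * (t + j%:R).
have angleE (j : 'I_N) : 2 * pi * q%:R / N%:R * (t + j%:R) = pi * angle j.
  by rewrite /angle; ring.
move: sinE; rewrite !angleE => /sin_pi_eq[] /intrP[z zE].
  case: kl; apply/val_inj.
  have : (q%:Z * (k%:Z - l%:Z))%:~R = (z * N%:Z)%:~R :> R.
    by rewrite !intrM intrB -!pmulrn -zE /angle; field.
  move=> /intr_inj /(congr1 absz); rewrite !abszM /= => qkl.
  have : (N %| q * `|k%:Z - l%:Z|)%N by rewrite qkl dvdn_mull.
  rewrite Gauss_dvdr // => N_dvd; have := ltn_ord k; have := ltn_ord l.
  have [|/dvdn_leq/(_ N_dvd)] := posnP `|k%:Z - l%:Z|%N; lia.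
have -> : 4 * q%:R * t = (2 * z * N%:Z - N%:Z - 2 * q%:Z * (k%:Z + l%:Z))%:~R.
  rewrite !intrB !intrM intrD -!pmulrn -zE /angle; field.
  by [].
exact: intr_int.
Qed.

Lemma psi_crossing_finite (a b : R) : finite_set (crossing_times f a b).
Proof.
apply: sub_finite_set (finite_lattice_itv a b (c := 4 * q%:R) _).
  by move=> t t_cross; split; [case: t_cross|apply: psi_crossing_lattice t_cross].
by rewrite mulr_gt0 ?ltr0n.
Qed.

Let endpoint_lt1 (eta : R) : 0 < eta < (4 * q%:R)^-1 -> 0 < 4 * q%:R * eta < 1.
Proof.
move=> /andP[eta0 eta1]; have q4 : 0 < 4 * q%:R :> R by rewrite mulr_gt0 ?ltr0n.
by rewrite mulr_gt0 //= mulrC -ltr_pdivlMr // div1r.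
Qed.

Lemma psi_endpoint (eta : R) : 0 < eta < (4 * q%:R)^-1 ->
  ~ crossing_times f eta eta eta.
Proof.
move=> /endpoint_lt1/andP[x0 x1] /psi_crossing_lattice/intrP[z zE].
by move: x0 x1; rewrite zE ltr0z ltrz1; lia.
Qed.

(** Times [t] with [4 q t] an integer cannot distinguish the window
    [[eta, 1 + eta]] from the half-open interval [(0, 1]]. *)
Lemma psi_window (eta eta' : R) :
    0 < eta < (4 * q%:R)^-1 -> 0 < eta' < (4 * q%:R)^-1 ->
  crossing_times f eta (1 + eta) = crossing_times f eta' (1 + eta').
Proof.
move=> eta_lt eta'_lt; apply/seteqP.
wlog suff: eta eta' eta_lt eta'_lt /
    (crossing_times f eta (1 + eta) `<=` crossing_times f eta' (1 + eta'))%classic.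
  by move=> W; split; apply: W.
move=> t t_cross; have [z zE] := intrP (psi_crossing_lattice t_cross).
have [/andP[lt_t t_lt] kl] := t_cross; split=> //.
have q4 : 0 < 4 * q%:R :> R by rewrite mulr_gt0 ?ltr0n.
have /andP[x0 x1] := endpoint_lt1 eta_lt.
have /andP[y0 y1] := endpoint_lt1 eta'_lt.
rewrite -(ler_pM2l q4) zE in lt_t; rewrite -(ler_pM2l q4) zE mulrDr mulr1 in t_lt.
rewrite -(ler_pM2l q4) -(ler_pM2l q4 t) zE mulrDr mulr1.
have z_gt0 : 0 < z by rewrite -(ltr0z R); lra.
have z_ge1 : 1 <= z%:~R :> R by rewrite ler1z -gtz0_ge1.
have z_le : z <= 4 * q%:Z.
  by rewrite -ltzD1 -(ltr_int R) intrD intrM -pmulrn; lra.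
have {}z_le : z%:~R <= 4 * q%:R :> R by move: z_le; rewrite -(ler_int R) intrM -pmulrn.
lra.
Qed.

Lemma read_psi_window (eta eta' : R) :
    0 < eta < (4 * q%:R)^-1 -> 0 < eta' < (4 * q%:R)^-1 ->
  read_braid f eta (1 + eta) = read_braid f eta' (1 + eta').
Proof.
by move=> h h'; rewrite /read_braid /projection_word (psi_window h h').
Qed.

End LissajousStrands.

(** * The power formula *)

(** The bound on [eta] is [1 / 4dq] because the reparametrized window of
    the braid with parameters [q] and [p] starts at [d eta], which must stay
    below [1 / 4q]. *)
Lemma lissajous_braid_dilate (R : realType) (N d q p : nat) (phi eta eta' : R)
    (N_gt0 : (0 < N)%N) (d_gt0 : (0 < d)%N) (q_gt0 : (0 < q)%N) :
    coprime N d -> coprime N q ->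
    0 < eta < (4 * (d * q)%:R)^-1 -> 0 < eta' < (4 * (d * q)%:R)^-1 ->
  (admissible_phase N (d * q) (d * p) phi eta <->
   admissible_phase N q p (d%:R * phi) eta') /\
  lissajous_braid N (d * q) (d * p) phi eta
    = (lissajous_braid N q p (d%:R * phi) eta' ^+ d)%g.
Proof.
move=> coNd coNq /andP[eta_gt0 eta_lt] /andP[eta'_gt0 eta'_lt].
have dR : 0 < d%:R :> R by rewrite ltr0n.
have dil_inj := @strand_mod_affine_inj N N_gt0 d 0 coNd.
have dilE := psi_dilate N_gt0 d q p phi.
have shift_inj := @strand_mod_affine_inj N N_gt0 1 1 (coprimen1 N).
have periodE := psi_period N_gt0.
split.
  have all_timesP q0 p0 (phi0 a : R) :
      admissible_phase N q0 p0 phi0 a <->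
      forall t, disjoint_at (psi (N := N) q0 p0 phi0) t.
    rewrite /admissible_phase addrC.
    exact: (disjoint_graphs_period shift_inj ltr01 (periodE R q0 p0 phi0) a).
  split=> /all_timesP disj; apply/all_timesP => t; last first.
    exact/(disjoint_at_affine dil_inj dilE).
  have -> : t = d%:R * (t / d%:R) + 0 by field; rewrite gt_eqF.
  exact/(disjoint_at_affine dil_inj dilE)/disj.
have deta_lt : 0 < d%:R * eta < (4 * q%:R)^-1.
  rewrite mulr_gt0 //= mulrC -ltr_pdivlMr // -invfM.
  by rewrite -mulrA -natrM mulnC.
have eta'_lt_q : 0 < eta' < (4 * q%:R)^-1.
  rewrite eta'_gt0 /=; apply: lt_le_trans eta'_lt _.
  rewrite lef_pV2 ?posrE ?mulr_gt0 ?ltr0n ?muln_gt0 ?d_gt0 //.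
  by rewrite ler_pM2l // ler_nat leq_pmull.
have coNdq : coprime N (d * q) by rewrite coprimeMr coNd.
have dq_gt0 : (0 < d * q)%N by rewrite muln_gt0 d_gt0.
rewrite /lissajous_braid (read_braid_affine dil_inj dR dilE); last first.
  exact: psi_crossing_finite.
rewrite -(read_psi_window N_gt0 p (d%:R * phi) q_gt0 coNq deta_lt eta'_lt_q).
rewrite [1 + d%:R * _]addrC.
rewrite -(read_braid_periodic shift_inj ltr01 (periodE R q p (d%:R * phi))).
- by congr (read_braid _ _ _); ring.
- exact: psi_crossing_finite.
- exact: psi_endpoint.
Qed.

Theorem proposition1 (R : realType) (N q p : nat)
    (N_gt0 : (0 < N)%N) (q_gt0 : (0 < q)%N) (p_gt0 : (0 < p)%N)
    (coNq : coprime N q) (coNp : coprime N p) (phi : R) :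
  let d := gcdn p q in
  let q' := (q %/ d)%N in
  let p' := (p %/ d)%N in
  let phi' := d%:R * phi in
  exists2 eps : R, 0 < eps &
    forall eta eta' : R, 0 < eta < eps -> 0 < eta' < eps ->
      (admissible_phase N q p phi eta <-> admissible_phase N q' p' phi' eta') /\
      (admissible_phase N q p phi eta ->
       lissajous_braid N q p phi eta
         = (lissajous_braid N q' p' phi' eta' ^+ d)%g).
Proof.
move=> d q' p' phi'.
have d_gt0 : (0 < d)%N by rewrite gcdn_gt0 p_gt0.
have d_dvd_q : (d %| q)%N by exact: dvdn_gcdr.
have qE : (d * q')%N = q by rewrite mulnC divnK.
have pE : (d * p')%N = p by rewrite mulnC divnK ?dvdn_gcdl.
have coNd : coprime N d by exact: coprime_dvdr coNq.
clearbody d q' p'.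
have q'_gt0 : (0 < q')%N by move: q_gt0; rewrite -qE muln_gt0 => /andP[].
have coNq' : coprime N q' by apply: coprime_dvdr coNq; rewrite -qE dvdn_mull.
exists (4 * q%:R)^-1; first by rewrite invr_gt0 mulr_gt0 ?ltr0n.
move=> eta eta' eta_lt eta'_lt; rewrite -qE in eta_lt eta'_lt.
have [adm braidE] :=
  lissajous_braid_dilate p' phi N_gt0 d_gt0 q'_gt0 coNd coNq' eta_lt eta'_lt.
by rewrite qE pE in adm braidE.
Qed.
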